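(* Let $L>0$, $\mu\ge0$, and let $f:\mathbb{R}^n\to\mathbb{R}$ be $L$-smooth and $\mu$-strongly convex with a minimizer $x_*$. Let $\alpha$ and $\beta$ satisfy $$0<\alpha\le\min\left\{\frac{1-\beta}{4L},\ \frac{(1-\beta)^2}{4L\sqrt{3\beta}}\right\},\qquad \beta\in[0,1),$$ where for $\beta=0$ the second term in the minimum is read as $+\infty$. Let $x_0\in\mathbb{R}^n$ and let $\overline{x}_K$ be the output after $K\ge0$ iterations of the Weighted Averaged Heavy-Ball method with stepsize $\alpha$, momentum parameter $\beta$, starting points $x_0$ and $x_1=x_0-\alpha\nabla f(x_0)$, and weights $w_k=\left(1-\frac{\alpha\mu}{2(1-\beta)}\right)^{-(k+1)}$. Then, with $W_K=\sum_{k=0}^Kw_k$, $$f(\overline{x}_K)-f(x_* )\le\frac{4(1-\beta)\|x_0-x_*\|_2^2}{\alpha W_K}.$$ That is, if $\mu>0$, then $$f(\overline{x}_K)-f(x_* )\le\left(1-\frac{\alpha\mu}{2(1-\beta)}\right)^K\frac{4(1-\beta)\|x_0-x_*\|_2^2}{\alpha},$$ and if $\mu=0$, then (for $K\ge1$) $$f(\overline{x}_K)-f(x_* )\le\frac{4(1-\beta)\|x_0-x_*\|_2^2}{\alpha K}.$$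
   Context: A differentiable $f:\mathbb{R}^n\to\mathbb{R}$ is $L$-smooth if $\|\nabla f(x)-\nabla f(y)\|_2\le L\|x-y\|_2$ for all $x,y$. It is $\mu$-strongly convex ($\mu\ge0$; $\mu=0$ means convex) if $f(y)\ge f(x)+\langle\nabla f(x),y-x\rangle+\frac\mu2\|y-x\|_2^2$ for all $x,y$. Weighted Averaged Heavy-Ball method (WAHB) with stepsize $\alpha>0$, momentum parameter $\beta$, starting points $x_0,x_1$ and positive weights $w_0,w_1,\dots$: for $k\ge1$, $x_{k+1}=x_k-\alpha\nabla f(x_k)+\beta(x_k-x_{k-1})$; and for every $K\ge0$, $\overline{x}_K=\frac1{W_K}\sum_{i=0}^Kw_ix_i$ with $W_K=\sum_{i=0}^Kw_i$. *)

(* Defs.v *)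
From HB Require Import structures.
From mathcomp Require Import all_boot all_order all_algebra.
From mathcomp Require Import all_classical all_reals all_analysis.
Set Implicit Arguments.
Unset Strict Implicit.
Unset Printing Implicit Defensive.
Import Order.TTheory GRing.Theory Num.Theory.
Import numFieldNormedType.Exports.
Local Open Scope ring_scope.

(* The library's norm on 'rV[R]_n is the sup norm, so the Euclidean inner
   product and norm are defined here.  Both norms induce the same topology and
   the same notion of (Frechet) differentiability. *)
Definition dotv (R : realType) (n : nat) (u v : 'rV[R]_n) : R :=
  \sum_(i < n) u 0 i * v 0 i.

Definition norm2 (R : realType) (n : nat) (u : 'rV[R]_n) : R :=
  Num.sqrt (dotv u u).

(* The vector of partial derivatives; meaningful where f is differentiable. *)
Definition grad (R : realType) (n : nat) (f : 'rV[R]_n -> R) (x : 'rV[R]_n)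
    : 'rV[R]_n :=
  \row_(i < n) 'D_(delta_mx 0 i) f x.

Definition L_smooth (R : realType) (n : nat) (L : R) (f : 'rV[R]_n -> R)
    : Prop :=
  (forall x, differentiable f x) /\
  (forall x y, norm2 (grad f x - grad f y) <= L * norm2 (x - y)).

Definition strongly_convex (R : realType) (n : nat) (mu : R)
    (f : 'rV[R]_n -> R) : Prop :=
  (forall x, differentiable f x) /\
  (forall x y,
     f y >= f x + dotv (grad f x) (y - x) + mu / 2 * norm2 (y - x) ^+ 2).

Definition minimizer (R : realType) (n : nat) (f : 'rV[R]_n -> R)
    (xs : 'rV[R]_n) : Prop :=
  forall y, f xs <= f y.

(* The starting points are x 0 and x 1. *)
Definition heavy_ball (R : realType) (n : nat) (f : 'rV[R]_n -> R)
    (alpha beta : R) (x : nat -> 'rV[R]_n) : Prop :=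
  forall k : nat, (1 <= k)%N ->
    x k.+1 = x k - alpha *: grad f (x k) + beta *: (x k - x k.-1).

Definition weight_sum (R : realType) (w : nat -> R) (K : nat) : R :=
  \sum_(0 <= i < K.+1) w i.

Definition weighted_average (R : realType) (n : nat) (w : nat -> R)
    (x : nat -> 'rV[R]_n) (K : nat) : 'rV[R]_n :=
  (weight_sum w K)^-1 *: \sum_(0 <= i < K.+1) w i *: x i.

Definition wahb_weight (R : realType) (alpha beta mu : R) (k : nat) : R :=
  (1 - alpha * mu / (2 * (1 - beta))) ^- k.+1.

(* For beta = 0 the second term of the minimum is +oo, so that the minimum is
   the first term; x / 0 = 0 in the library rules out a uniform formula. *)
Definition max_stepsize (R : realType) (L beta : R) : R :=
  if beta == 0 then (1 - beta) / (4 * L)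
  else Num.min ((1 - beta) / (4 * L))
               ((1 - beta) ^+ 2 / (4 * L * Num.sqrt (3 * beta))).

(* Main.v *)
Require Import Defs.
From HB Require Import structures.
From mathcomp Require Import all_boot all_order all_algebra.
From mathcomp Require Import all_classical all_reals all_analysis.
From mathcomp Require Import ring lra.
Import Order.TTheory GRing.Theory Num.Theory.
Import numFieldNormedType.Exports.
Local Open Scope ring_scope.


(** The heavy-ball iterates are gradient descent in disguise.  Put
    d_k = beta / (1 - beta) (x_k - x_(k-1)), with d_0 = 0, and
    gamma = alpha / (1 - beta).  The virtual iterates y_k = x_k + d_k satisfy
    y_(k+1) = y_k - gamma grad f(x_k): a gradient step of length gamma, except
    that the gradient is taken at x_k instead of y_k.  The choice of x_1 makes
    this hold from k = 0 on.

    Expanding the squared distance and using strong convexity at x_k gives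
    ([gradient_step_contraction])
      |y_(k+1) - xs|^2 <= q |y_k - xs|^2 - gamma (f(x_k) - f(xs))
                          + 5 L gamma |d_k|^2,
    with q = 1 - gamma mu / 2 the inverse ratio of the weights.  The error
    d_k obeys d_(k+1) = beta d_k - beta gamma grad f(x_k), so that by
    convexity of the squared norm ([momentum_recursion]) |d_k|^2 contracts by
    beta up to a multiple of |grad f(x_k)|^2, and the latter is at most
    2 L (f(x_k) - f(xs)) ([grad_sqr_le_gap]).

    Therefore the Lyapunov function
      V_k = |y_k - xs|^2 + A |d_k|^2,   A = 10 L gamma / (1 - beta),
    satisfies V_(k+1) <= q V_k - gamma / 4 (f(x_k) - f(xs)).  Two consequences
    of the stepsize bounds enter: q - beta >= (1 - beta) / 2, by which A is
    large enough to absorb 5 L gamma |d_k|^2; and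
    48 (alpha L)^2 beta <= (1 - beta)^4, by which the error created by one
    gradient costs less than 3/4 of the decrease gamma (f(x_k) - f(xs)).
    Dividing by q^(k+1) and telescoping ([geometric_lyapunov_sum]) bounds the
    weighted sum of the gaps by 4 V_0 / gamma, V_0 = |x_0 - xs|^2, and Jensen's
    inequality ([jensen_weighted_average]) passes to the average.  The last
    two bounds follow from W_K >= w_K and from W_K = K + 1 when mu = 0.

    Positivity of q rests on mu <= L, which fails to follow from the
    hypotheses when n = 0; there all points coincide and both sides vanish. *)

(** * The Euclidean inner product *)

Section InnerProduct.
Context {R : realType} {n : nat}.
Implicit Types (u v w : 'rV[R]_n) (a : R).

Lemma dotvC u v : dotv u v = dotv v u.
Proof. by apply: eq_bigr => i _; rewrite mulrC. Qed.

Lemma dotvDl u v w : dotv (u + v) w = dotv u w + dotv v w.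
Proof. by rewrite /dotv -big_split; apply: eq_bigr => i _; rewrite mxE mulrDl. Qed.

Lemma dotvZl a u v : dotv (a *: u) v = a * dotv u v.
Proof. by rewrite /dotv big_distrr; apply: eq_bigr => i _; rewrite mxE /= mulrA. Qed.

Lemma dotvDr u v w : dotv u (v + w) = dotv u v + dotv u w.
Proof. by rewrite dotvC dotvDl !(dotvC u). Qed.

Lemma dotvZr a u v : dotv u (a *: v) = a * dotv u v.
Proof. by rewrite dotvC dotvZl dotvC. Qed.

Lemma dotvNl u v : dotv (- u) v = - dotv u v.
Proof. by rewrite -scaleN1r dotvZl mulN1r. Qed.

Lemma dotvNr u v : dotv u (- v) = - dotv u v.
Proof. by rewrite dotvC dotvNl dotvC. Qed.

Lemma dotv0r u : dotv u 0 = 0.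
Proof. by rewrite -(scale0r u) dotvZr mul0r. Qed.

Definition dotv_linear := (dotvDl, dotvDr, dotvZl, dotvZr, dotvNl, dotvNr).

Lemma dotv_sumr u (I : Type) (r : seq I) (F : I -> 'rV[R]_n) :
  dotv u (\sum_(i <- r) F i) = \sum_(i <- r) dotv u (F i).
Proof. exact: (big_morph (dotv u) (dotvDr u) (dotv0r u)). Qed.

Lemma dotvv_ge0 u : 0 <= dotv u u.
Proof. by apply: sumr_ge0 => i _; rewrite -expr2 sqr_ge0. Qed.

Lemma sqr_norm2 u : norm2 u ^+ 2 = dotv u u.
Proof. by rewrite sqr_sqrtr // dotvv_ge0. Qed.

End InnerProduct.

(** * Smooth strongly convex functions *)

Section SmoothConvex.
Context {R : realType} {n : nat} {L mu : R} {f : 'rV[R]_n -> R}.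
Hypotheses (L_gt0 : 0 < L) (mu_ge0 : 0 <= mu).
Hypotheses (f_smooth : L_smooth L f) (f_convex : strongly_convex mu f).
Implicit Types (x y v : 'rV[R]_n).

Lemma strongly_convex_ge x y :
  f x + dotv (grad f x) (y - x) + mu / 2 * dotv (y - x) (y - x) <= f y.
Proof. by rewrite -sqr_norm2; case: f_convex => _; apply. Qed.

Lemma convex_ge x y : f x + dotv (grad f x) (y - x) <= f y.
Proof.
apply: le_trans (strongly_convex_ge x y); rewrite lerDl.
by rewrite mulr_ge0 ?dotvv_ge0 // divr_ge0.
Qed.

(** Young's inequality replaces Cauchy-Schwarz here: with a the difference of
    gradients and v that of the points, 0 <= |a - L v|^2 and |a| <= L |v| give
    2 L <a, v> <= 2 L^2 |v|^2. *)
Lemma grad_lipschitz_inner x y :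
  dotv (grad f y - grad f x) (y - x) <= L * dotv (y - x) (y - x).
Proof.
set g := _ - grad f x; set v := y - x.
have lip : dotv g g <= L ^+ 2 * dotv v v.
  rewrite -!sqr_norm2 -exprMn lerXn2r ?nnegrE ?mulr_ge0 ?sqrtr_ge0 ?(ltW L_gt0) //.
  by case: f_smooth => _; apply.
clearbody g v.
have := dotvv_ge0 (g - L *: v); rewrite !dotv_linear (dotvC v g) => young.
by rewrite -(ler_pM2l L_gt0); lra.
Qed.

(** Convexity at x + v and the Lipschitz gradient give the descent inequality
    with L in place of L / 2, that is, with L / 2 multiplied by 1 + c for c = 1.
    Applying an estimate with factor 1 + c to the two halves of the segment
    improves it to factor 1 + c / 2, so the exact constant is approached
    without integrating the gradient along the segment.  The slower rate
    1 / (N + 1) is enough for that. *)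
Lemma descent_bisection (N : nat) x v :
  f (x + v) <= f x + dotv (grad f x) v + L / 2 * (1 + N.+1%:R^-1) * dotv v v.
Proof.
elim: N x v => [|N IH] x v.
  have := convex_ge (x + v) x; have := grad_lipschitz_inner x (x + v).
  rewrite opprD addNKr addrAC subrr add0r !dotv_linear invr1; lra.
set h : 'rV[R]_n := 2^-1 *: v.
have xv : x + v = x + h + h.
  by rewrite -addrA -scalerDl (_ : 2^-1 + 2^-1 = 1) ?scale1r //; lra.
have := IH (x + h) h; have := IH x h; have := grad_lipschitz_inner x (x + h).
rewrite -xv addrAC subrr add0r !dotv_linear.
have halve : N.+1%:R^-1 / 2 <= N.+2%:R^-1 :> R.
  rewrite -invfM lef_pV2 ?posrE ?mulr_gt0 ?ltr0n // -natrM ler_nat.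
  by rewrite muln2 doubleS !ltnS -addnn leq_addr.
have := ler_wpM2r (mulr_ge0 (ltW L_gt0) (dotvv_ge0 v)) halve.
by set c := N.+1%:R^-1; set c' := N.+2%:R^-1; lra.
Qed.

Lemma descent x v :
  f (x + v) <= f x + dotv (grad f x) v + L / 2 * dotv v v.
Proof.
apply/ler_addgt0Pr => e e_gt0.
set A := L / 2 * dotv v v.
have A_ge0 : 0 <= A by rewrite mulr_ge0 ?dotvv_ge0 // divr_ge0 // ltW.
set N := Num.trunc (A / e).
have AN : A * N.+1%:R^-1 <= e.
  rewrite ler_pdivrMr ?ltr0n // -ler_pdivrMl // mulrC.
  by apply: ltW; rewrite truncnS_gt.
have := descent_bisection N x v; move: AN; rewrite /A.
by set c := N.+1%:R^-1; lra.
Qed.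

(** A gradient step of length 1 / L decreases f by at least
    |grad f x|^2 / (2 L), and f cannot go below its minimum. *)
Lemma grad_sqr_le_gap xs x :
  minimizer f xs -> dotv (grad f x) (grad f x) <= 2 * L * (f x - f xs).
Proof.
move=> /(_ (x + - L^-1 *: grad f x)) min_le.
have := le_trans min_le (descent x _); rewrite !dotv_linear.
set G := dotv _ _ => le_f.
have -> : G = 2 * L * (L^-1 * G - L / 2 * (L^-1 * (L^-1 * G))).
  by field; rewrite gt_eqF.
by rewrite ler_pM2l ?mulr_gt0 //; lra.
Qed.

(** Along a unit vector v, strong convexity bounds the increment of
    <grad f, v> from below by mu, and smoothness bounds it from above by L.
    A unit vector exists only in positive dimension. *)
Lemma strong_convexity_le_smoothness : (0 < n)%N -> mu <= L.
Proof.
move=> n_gt0; pose v : 'rV[R]_n := delta_mx 0 (Ordinal n_gt0).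
have v1 : dotv v v = 1.
  rewrite /dotv (bigD1 (Ordinal n_gt0)) //= big1 => [|i /negPf ne_i].
    by rewrite mxE !eqxx mulr1 addr0.
  by rewrite !mxE ne_i andbF mulr0.
have := strongly_convex_ge 0 v; have := strongly_convex_ge v 0.
have := grad_lipschitz_inner 0 v.
rewrite !subr0 sub0r !dotv_linear v1; lra.
Qed.

(** The tangent plane of f at the average is a minorant of f, and its linear
    part cancels in the weighted sum. *)
Lemma jensen_weighted_average (w : nat -> R) (x : nat -> 'rV[R]_n) (K : nat)
    (c : R) : (forall k, 0 < w k) ->
  weight_sum w K * (f (weighted_average w x K) - c)
    <= \sum_(0 <= k < K.+1) w k * (f (x k) - c).
Proof.
move=> w_gt0; set W := weight_sum w K; set z := weighted_average w x K.
have W_gt0 : 0 < W.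
  rewrite /W /weight_sum big_nat_recl //= ltr_wpDr //.
  by rewrite sumr_ge0 // => k _; exact: ltW.
have Wz : \sum_(0 <= k < K.+1) w k *: x k = W *: z.
  by rewrite /z /weighted_average scalerA divff ?scale1r // gt_eqF.
have first_order : \sum_(0 <= k < K.+1) w k * dotv (grad f z) (x k - z) = 0.
  rewrite (eq_bigr _ (fun k _ => esym (dotvZr _ _ _))) -dotv_sumr.
  rewrite (eq_bigr _ (fun k _ => scalerBr _ _ _)) sumrB Wz -scaler_suml subrr.
  exact: dotv0r.
rewrite -[leLHS]addr0 -[X in _ + X <= _]first_order mulr_suml -big_split /=.
apply: ler_sum => k _; rewrite -mulrDr ler_pM2l //.
by have := convex_ge z (x k); lra.
Qed.

(** In this gradient step the gradient is evaluated at x while the step starts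
    from x + d.  With u = x + d - xs and g = grad f x, the square expands to
    |u|^2 - 2 gamma <g, u> + gamma^2 |g|^2, and <g, u> = <g, x - xs> + <g, d>.
    Strong convexity bounds <g, x - xs> from below by the gap plus
    mu / 2 |u - d|^2, where |u - d|^2 >= |u|^2 / 2 - |d|^2.  Young's inequality
    on <g, d> and the second-order term gamma^2 |g|^2 each cost half of
    gamma times the gap, so one of the two gaps survives. *)
Lemma gradient_step_contraction xs x d (gamma : R) :
  minimizer f xs -> mu <= L -> 0 <= gamma -> 4 * gamma * L <= 1 ->
  dotv (x + d - gamma *: grad f x - xs) (x + d - gamma *: grad f x - xs)
  <= (1 - gamma * mu / 2) * dotv (x + d - xs) (x + d - xs)
     - gamma * (f x - f xs) + 5 * L * gamma * dotv d d.
Proof.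
move=> xs_min mu_le_L gamma_ge0 gammaL.
set g := grad f x; set u := x + d - xs.
have -> : x + d - gamma *: g - xs = u - gamma *: g by rewrite addrAC.
have xs_x : xs - x = d - u by rewrite /u; apply/rowP => i; rewrite !mxE; ring.
have := strongly_convex_ge x xs; rewrite xs_x -/g.
have := dotvv_ge0 (u - 2 *: d).
have := dotvv_ge0 (g + (4 * L) *: d).
have gap : f xs <= f x by exact: xs_min.
have := grad_sqr_le_gap xs x xs_min; rewrite -/g.
clearbody g u; rewrite !dotv_linear (dotvC d u) (dotvC u g) (dotvC d g).
have := dotvv_ge0 d.
move: (dotv d d) (dotv u u) (dotv g g) (dotv g u) (dotv g d) (dotv u d) => E D G gu gd ud.
set delta := f x - f xs => E_ge0 G_le young split sc.
have {}young : - 2 * gd <= delta / 2 + 4 * L * E.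
  by rewrite -(ler_pM2l L_gt0); lra.
have step : gamma * G <= delta / 2.
  apply: (le_trans (ler_wpM2l gamma_ge0 G_le)).
  have : 0 <= delta by rewrite subr_ge0.
  by move=> /(ler_wpM2r)/(_ _ _ gammaL); lra.
have strong : - mu / 2 * (D - 2 * ud + E) <= - mu / 4 * D + mu / 2 * E.
  have := mulr_ge0 mu_ge0 split; lra.
have muE : mu * E <= L * E by rewrite ler_wpM2r.
(* The constant 5 collects 4 L from young and mu <= L from strong. *)
suff : - 2 * gu + gamma * G <= - mu / 2 * D - delta + 5 * L * E.
  by move=> /(ler_wpM2l gamma_ge0); lra.
by rewrite /delta in young step *; lra.
Qed.

End SmoothConvex.

(** * Momentum, stepsizes and Lyapunov sums *)

(** Convexity of the squared norm, for the combination of d and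
    - c / (1 - beta) g with weights beta and 1 - beta. *)
Lemma momentum_recursion {R : realType} {n : nat} (d g : 'rV[R]_n) (beta c : R) :
  0 <= beta < 1 ->
  dotv (beta *: d - c *: g) (beta *: d - c *: g)
    <= beta * dotv d d + c ^+ 2 / (1 - beta) * dotv g g.
Proof.
move=> /andP[beta_ge0 beta_lt1].
have b_gt0 : 0 < 1 - beta by rewrite subr_gt0.
rewrite -subr_ge0.
(* The difference of the two sides is the defect in Jensen's inequality. *)
have := mulr_ge0 (mulr_ge0 beta_ge0 (ltW b_gt0))
  (dotvv_ge0 (d + (c / (1 - beta)) *: g)).
congr (0 <= _); rewrite !dotv_linear (dotvC g d); field.
by rewrite gt_eqF.
Qed.

(** Squaring the second bound of the minimum removes the root and yields an
    inequality that also covers beta = 0, where it is trivial. *)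
Lemma max_stepsizeP {R : realType} (L alpha beta : R) :
  0 < L -> 0 <= beta < 1 -> 0 < alpha <= max_stepsize L beta ->
  4 * alpha * L <= 1 - beta /\
  48 * (alpha * L) ^+ 2 * beta <= (1 - beta) ^+ 4.
Proof.
move=> L_gt0 /andP[beta_ge0 beta_lt1] /andP[alpha_gt0].
have b_gt0 : 0 < 1 - beta by rewrite subr_gt0.
have L4 : 0 < 4 * L by rewrite mulr_gt0.
rewrite /max_stepsize; case: eqVneq => [beta0|beta_neq0].
  rewrite ler_pdivlMr // => le1; split; first by lra.
  by rewrite beta0 mulr0 subr0 expr1n.
have s_gt0 : 0 < Num.sqrt (3 * beta).
  by rewrite sqrtr_gt0 mulr_gt0 // lt0r beta_neq0.
rewrite le_min ler_pdivlMr // ler_pdivlMr ?mulr_gt0 // => /andP[le1 le2].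
split; first by lra.
have : (alpha * (4 * L * Num.sqrt (3 * beta))) ^+ 2 <= ((1 - beta) ^+ 2) ^+ 2.
  by rewrite lerXn2r ?nnegrE ?exprn_ge0 ?mulr_ge0 // ltW.
rewrite -exprM !exprMn sqr_sqrtr ?mulr_ge0 //; lra.
Qed.

(** This bound makes gamma mu / 2 at most (1 - beta) / 2, so that the
    contraction factor of the distance stays away from beta.  For beta <= 3/4
    the first hypothesis suffices, since then 1/4 <= 1 - beta; for larger beta
    the second does, since then 48 beta >= 1. *)
Lemma stepsize_le_sqr {R : realType} (t beta : R) :
  0 <= t -> 0 <= beta < 1 ->
  4 * t <= 1 - beta -> 48 * t ^+ 2 * beta <= (1 - beta) ^+ 4 ->
  t <= (1 - beta) ^+ 2.
Proof.
move=> t_ge0 /andP[beta_ge0 beta_lt1] le1 le2.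
have [beta_le|beta_gt] := lerP beta (3 / 4).
  nra.
rewrite -(@ler_pXn2r _ 2) ?nnegrE ?exprn_ge0 ?subr_ge0 ?(ltW beta_lt1) //.
rewrite -exprM; apply: le_trans le2.
have := sqr_ge0 t; nra.
Qed.

(** Divided by q^(k+1), the recursion telescopes. *)
Lemma geometric_lyapunov_sum {R : realType} (V delta : nat -> R) (q c : R) K :
  0 < q -> (forall k, 0 <= V k) ->
  (forall k, V k.+1 <= q * V k - c * delta k) ->
  c * \sum_(0 <= k < K) q ^- k.+1 * delta k <= V 0%N.
Proof.
move=> q_gt0 V_ge0 V_dec.
(* The induction keeps the last Lyapunov term, dropped in the conclusion. *)
suff: c * (\sum_(0 <= k < K) q ^- k.+1 * delta k) + q ^- K * V K <= V 0%N.
  by apply: le_trans; rewrite lerDl mulr_ge0 // invr_ge0 exprn_ge0 ?ltW.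
elim: K => [|K IH]; first by rewrite big_geq // mulr0 add0r expr0 invr1 mul1r.
apply: le_trans IH; rewrite big_nat_recr //= mulrDr -addrA lerD2l.
have qV : q ^- K * V K = q ^- K.+1 * (q * V K).
  by rewrite exprSr invfM -mulrA mulKf // gt_eqF.
have qK : 0 <= q ^- K.+1 by rewrite invr_ge0 exprn_ge0 // ltW.
by rewrite qV; have := ler_wpM2l qK (V_dec K); lra.
Qed.

Theorem theorem3p4 (R : realType) (n : nat) (L mu : R) (f : 'rV[R]_n -> R)
    (xs : 'rV[R]_n) (alpha beta : R) (x : nat -> 'rV[R]_n) (K : nat)
    (hL : 0 < L) (hmu : 0 <= mu)
    (hsmooth : L_smooth L f) (hconvex : strongly_convex mu f)
    (hmin : minimizer f xs)
    (hbeta : 0 <= beta < 1)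
    (halpha : 0 < alpha <= max_stepsize L beta)
    (hx1 : x 1%N = x 0%N - alpha *: grad f (x 0%N))
    (hx : heavy_ball f alpha beta x) :
  let w := wahb_weight alpha beta mu in
  let xbar := weighted_average w x K in
  [/\ f xbar - f xs <=
        4 * (1 - beta) * norm2 (x 0%N - xs) ^+ 2 / (alpha * weight_sum w K),
      0 < mu ->
        f xbar - f xs <=
          (1 - alpha * mu / (2 * (1 - beta))) ^+ K *
          (4 * (1 - beta) * norm2 (x 0%N - xs) ^+ 2 / alpha) &
      mu = 0 -> (1 <= K)%N ->
        f xbar - f xs <=
          4 * (1 - beta) * norm2 (x 0%N - xs) ^+ 2 / (alpha * K%:R)].
Proof.
move=> w xbar.
have [n0|n_gt0] := posnP n.
  subst n.
  have norm0 : norm2 (x 0%N - xs) ^+ 2 = 0 by rewrite sqr_norm2 /dotv big_ord0.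
  have -> : xbar = xs by rewrite [xbar]thinmx0 [xs]thinmx0.
  by rewrite norm0 subrr !(mulr0, mul0r).
have mu_le_L := strong_convexity_le_smoothness hL hsmooth hconvex n_gt0.
have [le1 le2] := max_stepsizeP _ _ _ hL hbeta halpha.
have /andP[alpha_gt0 _] := halpha; have /andP[beta_ge0 beta_lt1] := hbeta.
have b_gt0 : 0 < 1 - beta by rewrite subr_gt0.
set q := 1 - alpha * mu / (2 * (1 - beta)).
pose gamma := alpha / (1 - beta).
have alphaE : alpha = gamma * (1 - beta) by rewrite divfK // gt_eqF.
have gamma_gt0 : 0 < gamma by rewrite divr_gt0.
have qE : q = 1 - gamma * mu / 2.
  by rewrite /q /gamma; field; rewrite gt_eqF.
have gammaL : 4 * gamma * L <= 1.
  by rewrite -(ler_pM2r b_gt0); move: le1; rewrite alphaE; lra.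
have gammaL_le : gamma * L <= 1 - beta.
  rewrite -(ler_pM2r b_gt0).
  have aL : 0 <= alpha * L by rewrite mulr_ge0 // ltW.
  have := @stepsize_le_sqr R (alpha * L) beta aL hbeta.
  rewrite mulrA => /(_ le1 le2); rewrite alphaE; lra.
have gammaL_sqr : 48 * ((gamma * L) ^+ 2 * beta) <= (1 - beta) ^+ 2.
  rewrite -(ler_pM2r (exprn_gt0 2 b_gt0)); move: le2; rewrite alphaE; lra.
have gammamu : gamma * mu <= gamma * L by rewrite ler_wpM2l // ltW.
have gammamu0 : 0 <= gamma * mu by rewrite mulr_ge0 // ltW.
have q_gap : (1 - beta) / 2 <= q - beta by rewrite qE; lra.
have q_gt0 : 0 < q by lra.
have q_le1 : q <= 1 by rewrite qE; lra.
(* The convention 0.-1 = 0 makes d 0 = 0 and lets xS hold at k = 0 too. *)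
pose d k := (beta / (1 - beta)) *: (x k - x k.-1).
pose g k := grad f (x k).
have xS k : x k.+1 = x k - alpha *: g k + beta *: (x k - x k.-1).
  case: k => [|k]; last exact: hx.
  by rewrite hx1 subrr scaler0 addr0.
have dS k : d k.+1 = beta *: d k - (beta * gamma) *: g k.
  rewrite /d /= xS; apply/rowP => i; rewrite !mxE /gamma; field.
  by rewrite gt_eqF.
have yS k : x k.+1 + d k.+1 = x k + d k - gamma *: g k.
  rewrite /d /= xS; apply/rowP => i; rewrite !mxE /gamma; field.
  by rewrite gt_eqF.
pose A := 10 * L * gamma / (1 - beta).
have A_ge0 : 0 <= A.
  by rewrite ltW // divr_gt0 //; apply: mulr_gt0 => //; apply: mulr_gt0.
pose V k := dotv (x k + d k - xs) (x k + d k - xs) + A * dotv (d k) (d k).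
pose delta k := f (x k) - f xs.
have V_ge0 k : 0 <= V k by rewrite /V addr_ge0 ?dotvv_ge0 // mulr_ge0 ?dotvv_ge0.
have V_dec k : V k.+1 <= q * V k - gamma / 4 * delta k.
  have := gradient_step_contraction hL hmu hsmooth hconvex _ (x k) (d k)
    _ hmin mu_le_L (ltW gamma_gt0) gammaL.
  have := momentum_recursion (d k) (g k) _ (beta * gamma) hbeta.
  have := grad_sqr_le_gap hL hmu hsmooth hconvex _ (x k) hmin.
  have := dotvv_ge0 (d k).
  have delta_ge0 : 0 <= delta k by rewrite subr_ge0; exact: hmin.
  rewrite /V yS dS -qE -/(g k) -/(delta k).
  move: (delta k) (dotv (d k) (d k)) (dotv (g k) (g k)) delta_ge0.
  move: (dotv (x k + d k - xs) _) => D del E G del_ge0 E_ge0 G_le mom contr.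
  have AE : 5 * L * gamma * E + A * beta * E <= q * A * E.
    suff le_A : 5 * L * gamma <= A * (q - beta).
      by have := ler_wpM2r E_ge0 le_A; lra.
    apply: le_trans (ler_wpM2l A_ge0 q_gap).
    by rewrite /A le_eqVlt; apply/orP; left; apply/eqP; field; rewrite gt_eqF.
  (* With G <= 2 L del, the coefficient of del is at most 20/48 gamma beta. *)
  have AG : A * ((beta * gamma) ^+ 2 / (1 - beta) * G) <= 3 / 4 * gamma * del.
    apply: le_trans (_ : A * ((beta * gamma) ^+ 2 / (1 - beta)) * (2 * L) * del <= _).
      rewrite mulrA -[leRHS]mulrA; apply: ler_wpM2l G_le.
      by rewrite mulr_ge0 // divr_ge0 ?sqr_ge0 // ltW.
    apply: ler_wpM2r => //; rewrite /A.
    have -> : 10 * L * gamma / (1 - beta) * ((beta * gamma) ^+ 2 / (1 - beta))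
        * (2 * L) = 20 * (gamma * beta) * ((gamma * L) ^+ 2 * beta)
                    / (1 - beta) ^+ 2.
      by field; rewrite gt_eqF.
    rewrite ler_pdivrMr ?exprn_gt0 //.
    have gb : 0 <= gamma * beta by rewrite mulr_ge0 // ltW.
    have gb_le : gamma * beta <= gamma by rewrite ler_piMr // ltW.
    have := ler_wpM2l gb gammaL_sqr.
    have := ler_wpM2r (sqr_ge0 (1 - beta)) gb_le; have := sqr_ge0 (1 - beta).
    have := mulr_ge0 (ltW gamma_gt0) (sqr_ge0 (1 - beta)); lra.
  have := ler_wpM2l A_ge0 mom; lra.
have w_gt0 k : 0 < w k by rewrite invr_gt0 exprn_gt0.
have W_ge : w K <= weight_sum w K.
  rewrite /weight_sum big_nat_recr //= lerDr.
  by apply: sumr_ge0 => k _; exact: ltW.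
have W_gt0 : 0 < weight_sum w K by exact: lt_le_trans W_ge.
have V0 : V 0%N = norm2 (x 0%N - xs) ^+ 2.
  by rewrite /V /d subrr scaler0 addr0 dotv0r mulr0 addr0 sqr_norm2.
have bound c : 0 < c -> c <= weight_sum w K ->
    f xbar - f xs <= 4 * (1 - beta) * norm2 (x 0%N - xs) ^+ 2 / (alpha * c).
  move=> c_gt0 c_le.
  have gap : 0 <= f xbar - f xs by rewrite subr_ge0; exact: hmin.
  have := geometric_lyapunov_sum _ _ _ _ K.+1 q_gt0 V_ge0 V_dec.
  have := jensen_weighted_average hmu hconvex w x K (f xs) w_gt0.
  rewrite -/xbar V0 => jensen.
  have := le_trans (ler_wpM2r gap c_le) jensen.
  rewrite -(@ler_pM2l _ (gamma / 4)) ?divr_gt0 // => le_sum /(le_trans le_sum).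
  rewrite ler_pdivlMr ?mulr_gt0 // => le_norm.
  rewrite alphaE [leRHS]mulrAC.
  have := ler_wpM2l (mulr_ge0 (ler0n R 4) (ltW b_gt0)) le_norm; lra.
split; first exact: bound.
- move=> _; apply: le_trans (bound _ (w_gt0 K) W_ge) _.
  rewrite invfM invrK [alpha^-1 * _]mulrC mulrCA ler_wpM2r //.
    by rewrite divr_ge0 ?(ltW alpha_gt0) // mulr_ge0 ?sqr_ge0 // mulr_ge0 // ltW.
  by rewrite exprS ler_piMl // exprn_ge0 // ltW.
- move=> mu0 K_gt0; apply: bound; first by rewrite ltr0n.
  rewrite /weight_sum (eq_bigr (fun=> 1)) => [|k _].
    by rewrite big_const_nat iter_addr addr0 subn0 ler_nat.
  by rewrite /w /wahb_weight mu0 mulr0 mul0r subr0 expr1n invr1.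
Qed.
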